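(* Let $a,b$ be relatively prime positive integers. If the zeta map $\zeta:\mathfrak{D}_{a,b}\to\mathfrak{D}_{a,b}$ is a bijection, then the conjugate-area map $\chi:\mathfrak{D}_{a,b}\to\mathfrak{D}_{a,b}$, $\chi(Q)=\zeta\big((\zeta^{-1}(Q))^c\big)$, is an area-preserving involution: $\chi(\chi(Q))=Q$ and $\mathrm{area}(\chi(Q))=\mathrm{area}(Q)$ for all $Q\in\mathfrak{D}_{a,b}$.
   Context: Let $a,b$ be relatively prime positive integers. An $(a,b)$-Dyck path is a lattice path from $(0,0)$ to $(b,a)$ with unit north steps and unit east steps, all of whose lattice points $(x,y)$ satisfy $ax\le by$; it is drawn in the grid with $a$ rows and $b$ columns. $\mathfrak{D}_{a,b}$ is the set of all of them. Hooks and cores: the unit box with southeast corner $(x,y)$ has hook filling $by-ax$. The positive hooks of $P$ are the positive hook fillings of the boxes of the grid lying below (southeast of) $P$; $\mathrm{area}(P)$ is the number of positive hooks of $P$. $\mathfrak{c}(P)$ is the partition whose set of first-column hook lengths is the set of positive hooks of $P$ (it is an $(a,b)$-core, i.e. has no hook length equal to $a$ or $b$). For a partition $\kappa$ and a positive integer $m$: consider the hook lengths of the boxes in the first column of $\kappa$; for each residue modulo $m$ that occurs take the largest such hook length; the rows of $\kappa$ with these first-column hook lengths are the $m$-rows. The $m$-boundary of $\kappa$ is the set of boxes with hook length less than $m$. Zeta: the partition bounded by a path is the partition whose Young diagram (English notation) is the set of boxes of the grid above (northwest of) the path. $\lambda(P)=(\lambda_1\ge\dots\ge\lambda_a)$ has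 as parts the numbers of $b$-boundary boxes in the $a$-rows of $\mathfrak{c}(P)$ (padded with zeros). $\zeta(P)$ is the $(a,b)$-Dyck path bounding $\lambda(P)$. Conjugation: $P^c$ is obtained by applying cyclic shifts to the step sequence of $P$ until a path lying strictly below the diagonal (except at its two endpoints) is obtained (there is exactly one such cyclic shift), and rotating this path by $180^\circ$. *)

(* Defs.v *)
From HB Require Import structures.
From mathcomp Require Import all_boot all_order all_algebra zify.

Import Order.TTheory GRing.Theory Num.Theory.

Set Implicit Arguments.
Unset Strict Implicit.
Unset Printing Implicit Defensive.

(* A lattice path is its step sequence: [true] is a north step and [false] an
   east step. Its k-th lattice point is (xpos w k, ypos w k). *)
Definition xpos (w : seq bool) (k : nat) : nat := count negb (take k w).
Definition ypos (w : seq bool) (k : nat) : nat := count id (take k w).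

Definition is_dyck (a b : nat) (w : seq bool) : bool :=
  [&& count id w == a, count negb w == b
    & all (fun k => a * xpos w k <= b * ypos w k) (iota 0 (size w).+1)].

(* A unit box is named by its southeast corner (x, y), with 1 <= x <= b and
   0 <= y < a. It lies northwest of the path when some lattice point of the
   path is weakly southeast of that corner, and southeast of the path when some
   lattice point is weakly northwest of the opposite corner (x - 1, y + 1). *)
Definition above (w : seq bool) (x y : nat) : bool :=
  has (fun k => (x <= xpos w k) && (ypos w k <= y)) (iota 0 (size w).+1).
Definition below (w : seq bool) (x y : nat) : bool :=
  has (fun k => (xpos w k < x) && (y < ypos w k)) (iota 0 (size w).+1).

(* The subtraction is truncated, so nonpositive fillings all become 0; only
   positive fillings are ever used. *)
Definition hook_filling (a b : nat) (p : nat * nat) : nat := b * p.2 - a * p.1.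

Definition grid (a b : nat) : seq (nat * nat) :=
  [seq (x, y) | y <- iota 0 a, x <- iota 1 b].

Definition positive_hooks (a b : nat) (w : seq bool) : seq nat :=
  [seq hook_filling a b p |
    p <- grid a b & below w p.1 p.2 && (0 < hook_filling a b p)].

Definition area (a b : nat) (w : seq bool) : nat := size (positive_hooks a b w).

(* Partitions are nonincreasing sequences; rows and columns are numbered from 0,
   and box (i, j) exists when j < nth 0 kappa i. For such a box the value below
   is (arm + 1) + leg. *)
Definition hook_length (kappa : seq nat) (i j : nat) : nat :=
  nth 0 kappa i - j + count (fun p => j < p) (drop i.+1 kappa).

(* In a partition without zero parts, the first-column hook length of a row is
   its part plus the number of rows below it, i.e. plus the number of smaller
   first-column hook lengths (see [first_column_hooks] and
   [first_column_core] below). *)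
Definition partition_of_hooks (H : seq nat) : seq nat :=
  [seq h - count (fun g => g < h) H | h <- sort geq H].

Definition core (a b : nat) (w : seq bool) : seq nat :=
  partition_of_hooks (positive_hooks a b w).

Definition rows_mod (m : nat) (kappa : seq nat) : seq nat :=
  [seq i <- iota 0 (size kappa) |
    all (fun i' => (hook_length kappa i' 0 == hook_length kappa i 0 %[mod m])
                   ==> (hook_length kappa i' 0 <= hook_length kappa i 0))
        (iota 0 (size kappa))].

Definition boundary_in_row (m : nat) (kappa : seq nat) (i : nat) : nat :=
  count (fun j => hook_length kappa i j < m) (iota 0 (nth 0 kappa i)).

Definition lambda (a b : nat) (w : seq bool) : seq nat :=
  let s := sort geq [seq boundary_in_row b (core a b w) i
                    | i <- rows_mod a (core a b w)] in
  s ++ nseq (a - size s) 0.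

(* Row i (from the top) of the grid consists of the boxes with y = a - 1 - i. *)
Definition bounded_partition (a b : nat) (w : seq bool) : seq nat :=
  [seq count (fun x => above w x (a - i.+1)) (iota 1 b) | i <- iota 0 a].

Definition strictly_below (a b : nat) (w : seq bool) : bool :=
  all (fun k => b * ypos w k < a * xpos w k) (iota 1 (size w).-1).

(* Traversing the half-turn of a path from (0,0) reads its steps backwards. *)
Definition conj_word (a b : nat) (w : seq bool) : seq bool :=
  let k := find (fun k => strictly_below a b (rot k w)) (iota 0 (size w)) in
  rev (rot k w).

Local Lemma sum_shift (f : nat -> int) m n :
  (\sum_(0 <= z < m + n) f z = \sum_(0 <= z < m) f z + \sum_(0 <= z < n) f (m + z)%N)%R.
Proof.
elim: n => [|n IH]; first by rewrite addn0 [X in (_ + X)%R]big_nil addr0.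
by rewrite addnS !big_nat_recr //= IH addrA.
Qed.

Local Lemma window (d : nat -> bool) a b :
  (forall z, z < a -> d z -> d (b + z)) ->
  (forall z, z < b -> d z -> d (a + z)) ->
  a * count d (iota 0 b) <= b * count d (iota b a).
Proof.
move=> ha hb.
have cE m n : ((count d (iota m n))%:R = \sum_(0 <= z < n) (d (m + z))%:R :> int)%R.
  elim: n m => [|n IH] m; first by rewrite big_nil.
  have -> : iota m n.+1 = iota m n ++ [:: m + n] by rewrite -addn1 iotaD.
by rewrite count_cat natrD IH big_nat_recr //= addn0.
set f := fun z => (d z)%:R%R : int.
have key : (0 <= \sum_(0 <= z < a) ((z%:R - a%:R) * (f z - f (b + z)%N))
             + \sum_(0 <= u < b) (u%:R * (f (a + u)%N - f u)))%R.
  apply: addr_ge0; rewrite big_nat_cond; apply: sumr_ge0 => z /andP[/andP[_ hz] _].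
    by rewrite /f; have := ha z hz; case: (d z); case: (d (b + z)) => //= h; rewrite ?(h isT); lia.
  by rewrite /f; have := hb z hz; case: (d z); case: (d (a + z)) => //= h; rewrite ?(h isT); lia.
have E1 : (\sum_(0 <= z < a) (z%:R - a%:R) * f z + \sum_(0 <= u < b) u%:R * f (a + u)%N
   = \sum_(0 <= u < b) (u%:R - a%:R) * f u
     + \sum_(0 <= z < a) (z%:R + b%:R - a%:R) * f (b + z)%N)%R.
  pose F z := ((z%:R - a%:R) * f z)%R.
  have := sum_shift F a b; rewrite addnC sum_shift => E.
  transitivity (\sum_(0 <= z < a) F z + \sum_(0 <= z < b) F (a + z)%N)%R.
    by congr (_ + _)%R; apply: eq_bigr => u _; rewrite /F; congr (_ * _)%R; lia.
  rewrite -E; congr (_ + _)%R.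
  by apply: eq_bigr => u _; rewrite /F; congr (_ * _)%R; lia.
rewrite -(ler_nat int) !natrM !cE -subr_ge0; apply: le_trans key _.
rewrite le_eqVlt; apply/orP; left; apply/eqP.
have K1 : (\sum_(0 <= z < a) ((z%:R - a%:R) * (f z - f (b + z)%N)) =
  \sum_(0 <= z < a) ((z%:R - a%:R) * f z)
  - \sum_(0 <= z < a) ((z%:R - a%:R) * f (b + z)%N))%R.
  by rewrite -sumrB; apply: eq_bigr => i _; rewrite mulrBr.
have K2 : (\sum_(0 <= u < b) (u%:R * (f (a + u)%N - f u)) =
  \sum_(0 <= u < b) (u%:R * f (a + u)%N) - \sum_(0 <= u < b) (u%:R * f u))%R.
  by rewrite -sumrB; apply: eq_bigr => i _; rewrite mulrBr.
have K3 : (\sum_(0 <= u < b) ((u%:R - a%:R) * f u) =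
  \sum_(0 <= u < b) (u%:R * f u) - a%:R * \sum_(0 <= u < b) (d (0 + u))%:R)%R.
  by rewrite mulr_sumr -sumrB; apply: eq_bigr => i _; rewrite mulrBl.
have K4 : (\sum_(0 <= z < a) ((z%:R + b%:R - a%:R) * f (b + z)%N) =
  \sum_(0 <= z < a) ((z%:R - a%:R) * f (b + z)%N)
  + b%:R * \sum_(0 <= z < a) (d (b + z))%:R)%R.
  by rewrite mulr_sumr -big_split; apply: eq_bigr => i _; rewrite addrAC mulrDl.
have alg (P Q R T u v : int) :
    (P + R = (T - u) + (Q + v) -> v - u = (P - Q) + (R - T))%R by lia.
by rewrite K1 K2; apply/esym/alg; rewrite -K3 -K4.
Qed.

Section PartitionOfHooks.
Variable H : seq nat.
Hypotheses (uH : uniq H) (pH : all (fun h => 0 < h) H).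

Local Notation s := (sort geq H).
Local Notation k := (size H).
Local Notation kappa := (partition_of_hooks H).
Local Notation S i := (nth 0 s i).

Lemma geq_total : total geq.
Proof. by move=> x y; rewrite /geq /= leq_total. Qed.

Local Lemma sz_s : size s = k. Proof. exact: size_sort. Qed.

Lemma size_partition_of_hooks : size kappa = k.
Proof. by rewrite size_map size_sort. Qed.

Local Lemma S_mono i j : i < j -> j < k -> S j < S i.
Proof.
have srt : sorted gtn s.
  by rewrite gtn_sorted_uniq_geq sort_uniq uH (sort_sorted geq_total).
move=> ij jk; apply: (sorted_ltn_nth _ 0 srt) => //; rewrite ?inE ?sz_s //.
  by move=> x y z /= h1 h2; apply: ltn_trans h2 h1.
exact: ltn_trans ij jk.
Qed.

Local Lemma S_mem i : i < k -> S i \in H.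
Proof. by move=> ik; rewrite -(mem_sort geq) mem_nth ?sz_s. Qed.

Local Lemma count_lt i : i < k -> count (fun g => g < S i) H = k - i.+1.
Proof.
move=> ik; rewrite -(permP (permEl (perm_sort geq H))).
rewrite -{2}(cat_take_drop i.+1 s) count_cat.
have -> : count (fun g => g < S i) (take i.+1 s) = 0.
  apply/eqP; rewrite -leqn0 leqNgt -has_count; apply/negP => /(has_nthP 0)[j].
  rewrite size_takel ?sz_s // ltnS => ji; rewrite nth_take ?ltnS // => hlt.
  case: (ltngtP j i) ji => // [ji|E] _.
    by have := S_mono ji ik; lia.
  by move: hlt; rewrite E ltnn.
rewrite add0n -[RHS](_ : size (drop i.+1 s) = _); last by rewrite size_drop sz_s.
apply/eqP; rewrite -all_count; apply/(all_nthP 0) => j.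
rewrite size_drop sz_s nth_drop => hj; apply: S_mono; lia.
Qed.

Local Lemma nth_part i : i < k -> nth 0 kappa i = S i - (k - i.+1).
Proof. by move=> ik; rewrite (nth_map 0) ?sz_s // count_lt. Qed.

Local Lemma count_mem_iota h : count (fun g => g \in H) (iota 0 h) = count (fun g => g < h) H.
Proof.
rewrite -!size_filter; apply: perm_size; apply: uniq_perm.
- by rewrite filter_uniq ?iota_uniq.
- by rewrite filter_uniq.
by move=> x; rewrite !mem_filter mem_iota add0n andbC.
Qed.

Local Lemma S_lb i : i < k -> k - i.+1 < S i.
Proof.
move=> ik; rewrite -count_lt // -count_mem_iota.
have : 0 < S i by apply: (allP pH); apply: S_mem.
case: (S i) => // n _ /=; have -> : 0 \in H = false.
  by apply/negP => /(allP pH).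
by rewrite add0n ltnS (leq_trans (count_size _ _)) ?size_iota.
Qed.

Local Lemma part_mono i j : i <= j -> j < k -> nth 0 kappa j <= nth 0 kappa i.
Proof.
move=> ij jk; have ik := leq_ltn_trans ij jk; rewrite !nth_part //.
have [->|lo] := eqVneq i j; first by [].
elim: j ij jk lo => [|j IH]; first by case: i {ik}.
move=> ij jk lo; have := S_mono (ltnSn j) jk.
case: (ltngtP i j.+1) ij lo => // lt _ _.
have [->|ne] := eqVneq i j; first by lia.
by have := IH _ _ ne; lia.
Qed.

Lemma partition_of_hooks_sorted : sorted geq kappa.
Proof.
case E : k => [|n].
  by move: size_partition_of_hooks; rewrite E => /size0nil ->.
apply/(sortedP 0) => i; rewrite size_partition_of_hooks => hi.
exact: part_mono.
Qed.

Lemma partition_of_hooks_gt0 : all (fun p => 0 < p) kappa.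
Proof.
apply/(all_nthP 0) => i; rewrite size_partition_of_hooks => ik.
by rewrite nth_part // subn_gt0 S_lb.
Qed.

Lemma first_column_hooks i : i < k -> hook_length kappa i 0 = S i.
Proof.
move=> ik; rewrite /hook_length subn0 (eqP (_ : count _ _ == k - i.+1)).
  by rewrite nth_part //; have := S_lb ik; lia.
rewrite -[k - _](_ : size (drop i.+1 kappa) = _); last first.
  by rewrite size_drop size_partition_of_hooks.
rewrite -all_count; apply/allP => x /mem_drop; exact/allP/partition_of_hooks_gt0.
Qed.

Local Notation e i j := (count (fun p => p <= j) (drop i.+1 kappa)).

Local Lemma hook_e i j : i < k -> j < nth 0 kappa i ->
  hook_length kappa i j + (j + e i j) = S i.
Proof.
move=> ik jk; rewrite /hook_length.
have := count_predC (fun p => j < p) (drop i.+1 kappa).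
rewrite size_drop size_partition_of_hooks.
rewrite (eq_count (a1 := predC _) (a2 := fun p => p <= j)); last by move=> p /=; rewrite -leqNgt.
by move: jk; rewrite nth_part //; have := S_lb ik; lia.
Qed.

Local Lemma e_notin i j : i < k -> j < nth 0 kappa i -> j + e i j \notin H.
Proof.
move=> ik jk; apply/negP; rewrite -(mem_sort geq) => /(nthP 0)[i']; rewrite sz_s => i'k E0.
have {E0}E : S i' = j + e i j := E0.
have hp : 0 < hook_length kappa i j by rewrite /hook_length; lia.
have ii' : i < i'.
  rewrite ltnNge; apply/negP => le; have := hook_e ik jk; rewrite -E.
  have [->|ne] := eqVneq i' i; first by move: hp; set q := hook_length _ _ _; lia.
  have lt : i' < i by rewrite ltn_neqAle ne.
  by have := S_mono lt ik; lia.
have Ed : drop i.+1 kappa = take (i' - i.+1) (drop i.+1 kappa) ++ drop i' kappa.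
  by rewrite -{1}(cat_take_drop (i' - i.+1) (drop i.+1 kappa)) drop_drop subnK.
have zd := size_drop i' kappa; rewrite size_partition_of_hooks in zd.
move: E (S_lb i'k) (nth_part i'k); rewrite Ed count_cat => E lb np.
have [le|gt] := leqP (nth 0 kappa i') j.
  have : count (fun p => p <= j) (drop i' kappa) = k - i'.
    rewrite -zd; apply/eqP; rewrite -all_count; apply/(all_nthP 0) => l.
    rewrite zd nth_drop => hl; apply: leq_trans le; apply: part_mono; lia.
  lia.
have c0 : count (fun p => p <= j) (take (i' - i.+1) (drop i.+1 kappa)) = 0.
  apply/eqP; rewrite -leqn0 leqNgt -has_count; apply/negP => /(has_nthP 0)[l].
  rewrite size_takel ?size_drop ?size_partition_of_hooks; last by lia.
  move=> hl; rewrite nth_take // nth_drop => hh.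
  have : nth 0 kappa i' <= nth 0 kappa (i.+1 + l) by apply: part_mono; lia.
  by lia.
have : count (fun p => p <= j) (drop i' kappa) <= k - i'.+1.
  rewrite (drop_nth 0) ?size_partition_of_hooks //= [nth 0 kappa i' <= j]leqNgt gt add0n.
  by rewrite (leq_trans (count_size _ _)) // size_drop size_partition_of_hooks.
lia.
Qed.

Lemma row_hooks i : i < k ->
  perm_eq [seq S i - hook_length kappa i j | j <- iota 0 (nth 0 kappa i)]
          [seq g <- iota 0 (S i) | g \notin H].
Proof.
move=> ik.
have Ee j : j < nth 0 kappa i -> S i - hook_length kappa i j = j + e i j.
  by move=> hj; rewrite -(hook_e ik hj) addKn.
set s1 := map _ _; set s2 := filter _ _.
have u1 : uniq s1.
  rewrite map_inj_in_uniq ?iota_uniq // => x y; rewrite !mem_iota /= !add0n => hx hy.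
  rewrite !Ee // => E.
  have em u v : u <= v -> e i u <= e i v by move=> uv; apply: sub_count => p /= /leq_trans->.
  have inj (u v : nat) : u + e i u = v + e i v -> u = v.
    by case: (ltngtP u v) => // uv; have := em _ _ (ltnW uv); lia.
  exact: inj.
have u2 : uniq s2 by rewrite filter_uniq ?iota_uniq.
have [||_ E] := uniq_min_size u1 (s2 := s2); last exact: uniq_perm.
- move=> x /mapP[j]; rewrite mem_iota /= add0n => hj ->.
  rewrite Ee // mem_filter e_notin //= mem_iota /= add0n.
  by have := hook_e ik hj; rewrite /hook_length; lia.
rewrite size_filter size_map size_iota nth_part //.
have := count_predC (fun g => g \in H) (iota 0 (S i)).
rewrite count_mem_iota count_lt // size_iota => h.
have -> : count (fun i0 => i0 \notin H) (iota 0 (S i)) =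
  count (predC (fun g => g \in H)) (iota 0 (S i)) by apply: eq_count.
lia.
Qed.

Lemma boundary_count b i : i < k ->
  boundary_in_row b kappa i = count (fun g => (g \notin H) && (S i < g + b)) (iota 0 (S i)).
Proof.
move=> ik; rewrite /boundary_in_row.
have := permP (row_hooks ik) (fun g => S i < g + b).
rewrite count_map count_filter => E.
transitivity (count (fun j => S i < S i - hook_length kappa i j + b) (iota 0 (nth 0 kappa i))).
  apply: eq_in_count => j; rewrite mem_iota /= add0n => hj.
  have hp : 0 < hook_length kappa i j by rewrite /hook_length; lia.
  by have := hook_e ik hj; lia.
by rewrite [LHS]E; apply: eq_count => g /=; rewrite andbC.
Qed.

End PartitionOfHooks.

Section TopBound.
Variables (a b : nat) (H T : seq nat).
Hypotheses (a_gt0 : 0 < a) (pH : all (fun h => 0 < h) H).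
Hypotheses (aH : a \notin H) (bH : b \notin H).
Hypotheses (clA : forall h, h \in H -> a < h -> h - a \in H).
Hypotheses (clB : forall h, h \in H -> b < h -> h - b \in H).
Hypotheses (uT : uniq T) (TH : {subset T <= H}).
Hypothesis (Tmod : {in T &, forall t t', t = t' %[mod a] -> t = t'}).

Local Notation v h := (count (fun g => (g \notin H) && (h < g + b)) (iota 0 h)).

Local Lemma addA g : g \notin H -> a + g \notin H.
Proof.
move=> gH; apply: contra gH => h; have [g0|g0] := posnP g.
  by move: h aH; rewrite g0 addn0 => ->.
by have := clA h; rewrite addKn; apply; lia.
Qed.

Local Lemma addB g : g \notin H -> b + g \notin H.
Proof.
move=> gH; apply: contra gH => h; have [g0|g0] := posnP g.
  by move: h bH; rewrite g0 addn0 => ->.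
by have := clB h; rewrite addKn; apply; lia.
Qed.

Local Lemma count_top h : 0 < h ->
  count (fun t => h <= t) T <= count (fun g => g \in H) (iota h a).
Proof.
move=> h0; rewrite -!size_filter.
rewrite -(size_map (fun t => h + (t - h) %% a) [seq t <- T | _]); apply: uniq_leq_size.
  rewrite map_inj_in_uniq ?filter_uniq // => t t'; rewrite !mem_filter.
  move=> /andP[ht tT] /andP[ht' t'T] /addnI E; apply: Tmod => //.
  by rewrite -(subnKC ht) -(subnKC ht') -modnDmr E modnDmr.
move=> x /mapP[t]; rewrite !mem_filter => /andP[ht tT] ->.
rewrite mem_iota leq_addr ltn_add2l ltn_mod a_gt0 !andbT.
have := TH tT; rewrite -{1}(subnKC ht) {1}(divn_eq (t - h) a).
elim: ((t - h) %/ a) => [|q IH]; first by rewrite mul0n add0n.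
move=> hq; apply: IH; have := clA hq; rewrite mulSn.
rewrite (_ : h + (a + q * a + (t - h) %% a) - a = h + (q * a + (t - h) %% a)); last by lia.
apply; lia.
Qed.

Local Lemma size_T : size T <= a.
Proof.
rewrite (leq_trans _ (leq_trans (count_top (ltn0Sn 0)) _)) //.
  suff /eqP-> : count (fun t => 0 < t) T == size T by [].
  by rewrite -all_count; apply/allP => t /TH /(allP pH).
by rewrite (leq_trans (count_size _ _)) ?size_iota.
Qed.

Local Lemma top_bound h : 0 < h ->
  a * v h <= b * (a - count (fun t => h <= t) T).
Proof.
move=> h0; pose d z := (b <= h + z) && (h + z - b \notin H).
have hw : a * count d (iota 0 b) <= b * count d (iota b a).
  apply: window => z _ /andP[bz hz]; rewrite /d.
    rewrite (_ : h + (b + z) - b = b + (h + z - b)) ?addB ?andbT //; lia.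
  rewrite (_ : h + (a + z) - b = a + (h + z - b)) ?addA ?andbT //; lia.
apply: leq_trans (leq_trans _ hw) _; rewrite leq_mul2l; apply/orP; right.
  rewrite -!size_filter -(size_map (fun g => g + b - h) [seq g <- iota 0 h | _]); apply: uniq_leq_size.
    rewrite map_inj_in_uniq ?filter_uniq ?iota_uniq // => x y; rewrite !mem_filter.
    by move=> /andP[/andP[_ hx] _] /andP[/andP[_ hy] _]; move: x y hx hy => /= x y; lia.
  move=> x /mapP[g]; rewrite !mem_filter !mem_iota /= !add0n => /andP[/andP[gH gb] gh] ->.
  rewrite /d (_ : h + (g + b - h) - b = g) ?gH; last by lia.
  by rewrite andbT; apply/andP; split; lia.
have -> : count d (iota b a) = count (fun g => g \notin H) (iota h a).
  rewrite -[b]addn0 -[h in RHS]addn0 !iotaDl !count_map; apply: eq_count => u /=.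
  have E1 : h + (b + u) - b = h + u by lia.
  have E2 : b <= h + (b + u) by lia.
  by rewrite /d E1 E2.
have := count_predC (fun g => g \in H) (iota h a); rewrite size_iota.
have := count_top h0.
have -> : count (fun g => g \notin H) (iota h a) =
  count (predC (fun g => g \in H)) (iota h a) by apply: eq_count.
lia.
Qed.

Local Lemma ex_min (s : seq nat) : 0 < size s -> exists2 h, h \in s & all (leq h) s.
Proof.
elim: s => // x [|y s] IH _; first by exists x; rewrite ?inE ?eqxx //= leqnn.
have [//|h hs hall] := IH; have [le|lt] := leqP x h.
  exists x; first by rewrite in_cons eqxx.
  by apply/andP; split; [exact: leqnn | apply: sub_all hall => z; exact: leq_trans].
exists h; first by rewrite in_cons hs orbT.
by apply/andP; split; [exact: ltnW | exact: hall].
Qed.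

Local Lemma sorted_bound i : i < size T ->
  a * nth 0 (sort geq [seq v t | t <- T]) i <= b * (a - i.+1).
Proof.
set V := map _ T; set s := sort geq V => iT.
have zs : size s = size T by rewrite size_sort size_map.
have srt : sorted geq s by exact: (sort_sorted geq_total).
set L := nth 0 s i.
have cL : i < count (fun t => L <= v t) T.
  have <- : count (fun x => L <= x) V = count (fun t => L <= v t) T by rewrite count_map.
  rewrite -(permP (permEl (perm_sort geq V))) -/s -(cat_take_drop i.+1 s) count_cat.
  have -> : count (fun x => L <= x) (take i.+1 s) = i.+1.
    rewrite -[RHS](_ : size (take i.+1 s) = _); last by rewrite size_takel // zs.
    apply/eqP; rewrite -all_count; apply/(all_nthP 0) => j.
    rewrite size_takel ?zs // ltnS => ji; rewrite nth_take ?ltnS //.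
    apply: (sorted_leq_nth _ _ 0 srt) => //; rewrite ?inE ?zs //.
      by move=> x y z /= h1 h2; apply: leq_trans h2 h1.
      by move=> x; exact: leqnn.
    exact: leq_ltn_trans ji iT.
  exact: leq_addr.
have [|h] := @ex_min [seq t <- T | L <= v t].
  by rewrite size_filter; apply: leq_ltn_trans cL.
rewrite mem_filter => /andP[Lh hT] hall.
have h0 : 0 < h by apply: (allP pH); apply: TH.
apply: leq_trans (_ : a * v h <= _); first by rewrite leq_mul2l Lh orbT.
apply: leq_trans (top_bound h0) _; rewrite leq_mul2l; apply/orP; right.
apply: leq_sub2l; apply: leq_trans cL _.
rewrite -!size_filter; apply: uniq_leq_size; first by rewrite filter_uniq.
by move=> t ht; move: (ht); rewrite !mem_filter => /andP[_ ->]; rewrite (allP hall _ ht).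
Qed.

End TopBound.

Section DyckHooks.
Variables (a b : nat) (w : seq bool).
Hypothesis (cab : coprime a b).
Local Notation H := (positive_hooks a b w).

Lemma mem_positive_hooks h : reflect
  (exists x y, [/\ 0 < x <= b, y < a, below w x y, a * x < b * y & h = b * y - a * x])
  (h \in H).
Proof.
apply: (iffP mapP) => [[[x y]]|[x [y [hx hy bel lt ->]]]].
  rewrite mem_filter /hook_filling subn_gt0 /= => /andP[/andP[bel lt]].
  case/allpairsP => -[y' x'] /= [hy hx [Ex Ey]] ->; subst y' x'.
  by exists x, y; move: hy hx; rewrite !mem_iota add0n add1n ltnS.
exists (x, y) => //; rewrite mem_filter /hook_filling subn_gt0 /= bel lt /=.
by apply/allpairsP; exists (y, x); rewrite !mem_iota /= add0n add1n ltnS.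
Qed.

Lemma positive_hooks_gt0 : all (fun h => 0 < h) H.
Proof. by apply/allP => h /mem_positive_hooks[x [y [_ _ _ lt ->]]]; rewrite subn_gt0. Qed.

Lemma positive_hooks_uniq : uniq H.
Proof.
have aux x y x' y' : y < a -> y' < a -> a * x < b * y -> a * x' < b * y' ->
    b * y - a * x = b * y' - a * x' -> y <= y' -> (x, y) = (x', y').
  move=> ya ya' lt lt' E le.
  have : a %| y' - y.
    rewrite -(Gauss_dvdr _ cab) mulnBr (_ : b * y' - b * y = a * (x' - x)) ?dvdn_mulr //.
    have h0 : b * y <= b * y' by rewrite leq_mul2l le orbT.
    by rewrite mulnBr; lia.
  have [y0|y0] := posnP (y' - y); last by move/(dvdn_leq y0); lia.
  have Ey : y = y' by lia.
  subst y'; move=> _; congr (_, _); apply/eqP.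
  by rewrite -(eqn_pmul2l (leq_ltn_trans (leq0n _) ya)); apply/eqP; lia.
rewrite map_inj_in_uniq ?filter_uniq //.
  apply: allpairs_uniq; rewrite ?iota_uniq // => -[y x] [y' x'] _ _ /= [-> ->] //.
move=> [x y] [x' y']; rewrite !mem_filter /hook_filling !subn_gt0 /=.
move=> /andP[/andP[_ lt] /allpairsP[[v u] /= [hy _ [_ Ey]]]]; subst v.
move=> /andP[/andP[_ lt'] /allpairsP[[v' u'] /= [hy' _ [_ Ey']]]]; subst v'.
move: hy hy'; rewrite !mem_iota !add0n /= => hy hy' E.
have [le|/ltnW le] := leqP y y'; first exact: aux.
by apply/esym/aux.
Qed.

Local Lemma below_mono x y x' y' : x <= x' -> y' <= y -> below w x y -> below w x' y'.
Proof.
move=> xx yy /hasP[k hk /andP[h1 h2]]; apply/hasP; exists k => //.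
by rewrite (leq_trans h1 xx) (leq_ltn_trans yy h2).
Qed.

Local Lemma hooks_subA h : h \in H -> a < h -> h - a \in H.
Proof.
case/mem_positive_hooks => x [y [/andP[x0 xb] ya bel lt ->]] ah.
have lt' : a * x.+1 < b * y by rewrite mulnS; lia.
apply/mem_positive_hooks; exists x.+1, y; split => //.
- rewrite /= -(leq_pmul2l (leq_ltn_trans (leq0n _) ya)); apply: leq_trans (ltnW lt') _.
  by rewrite mulnC leq_mul2r (ltnW ya) orbT.
- exact: below_mono bel.
by rewrite mulnS; lia.
Qed.

Local Lemma hooks_subB h : h \in H -> b < h -> h - b \in H.
Proof.
case/mem_positive_hooks => x [[|y] [/andP[x0 xb] ya bel lt ->]] bh.
  by rewrite muln0 in lt.
apply/mem_positive_hooks; exists x, y; split => //.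
- by rewrite x0.
- exact: ltnW.
- exact: below_mono bel.
- by move: bh; rewrite mulnS; lia.
by rewrite mulnS; lia.
Qed.

Local Lemma a_notin : a \notin H.
Proof.
apply/negP => /mem_positive_hooks[x [y [_ ya _ lt E]]].
have : a %| y by rewrite -(Gauss_dvdr _ cab) (_ : b * y = a * x.+1) ?dvdn_mulr // mulnS; lia.
have [y0|y0] := posnP y; first by move: lt; rewrite y0 muln0.
by move/(dvdn_leq y0); lia.
Qed.

Local Lemma b_notin : b \notin H.
Proof.
apply/negP => /mem_positive_hooks[x [[|y] [/andP[x0 xb] ya _ lt E]]].
  by rewrite muln0 in lt.
have Ey : a * x = b * y by move: E lt; rewrite mulnS; lia.
have : b %| x.
  by rewrite -(@Gauss_dvdr b a) ?Ey ?dvdn_mulr // coprime_sym.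
move/(dvdn_leq x0) => bx; have Ex : x = b by lia.
move: Ey; rewrite Ex mulnC => /eqP; rewrite eqn_pmul2l; last by lia.
by move/eqP; lia.
Qed.

Lemma first_column_core :
  [seq hook_length (core a b w) i 0 | i <- iota 0 (size (core a b w))] = sort geq H.
Proof.
apply: (@eq_from_nth _ 0).
  by rewrite size_map size_iota size_partition_of_hooks size_sort.
move=> i; rewrite size_map size_iota size_partition_of_hooks => hi.
rewrite (nth_map 0) ?size_iota ?size_partition_of_hooks // nth_iota ?size_partition_of_hooks //.
by rewrite first_column_hooks ?positive_hooks_uniq ?positive_hooks_gt0.
Qed.

Local Notation tops := [seq nth 0 (sort geq H) i | i <- rows_mod a (core a b w)].
Local Notation v h := (count (fun g => (g \notin H) && (h < g + b)) (iota 0 h)).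

Local Lemma rows_lt i : i \in rows_mod a (core a b w) -> i < size H.
Proof. by rewrite mem_filter mem_iota size_partition_of_hooks => /andP[]. Qed.

Local Lemma lambda_unsorted :
  [seq boundary_in_row b (core a b w) i | i <- rows_mod a (core a b w)] = [seq v t | t <- tops].
Proof.
rewrite -map_comp; apply/eq_in_map => i /rows_lt hi /=.
by rewrite boundary_count ?positive_hooks_uniq ?positive_hooks_gt0.
Qed.

Local Lemma tops_sub : {subset tops <= H}.
Proof.
move=> t /mapP[i /rows_lt hi ->]; rewrite -(mem_sort geq) mem_nth ?size_sort //.
Qed.

Local Lemma tops_uniq : uniq tops.
Proof.
rewrite map_inj_in_uniq ?filter_uniq ?iota_uniq // => i j /rows_lt hi /rows_lt hj /eqP.
by rewrite nth_uniq ?size_sort ?sort_uniq ?positive_hooks_uniq // => /eqP.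
Qed.

Local Lemma tops_mod : {in tops &, forall t t', t = t' %[mod a] -> t = t'}.
Proof.
have fc i : i < size H -> hook_length (core a b w) i 0 = nth 0 (sort geq H) i.
  by move=> hi; rewrite first_column_hooks ?positive_hooks_uniq ?positive_hooks_gt0.
move=> t t' /mapP[i hi ->] /mapP[j hj ->] E.
have li := rows_lt hi; have lj := rows_lt hj; apply/eqP; rewrite eqn_leq.
move: hi hj; rewrite !mem_filter => /andP[/allP/(_ j) hi _] /andP[/allP/(_ i) hj _].
move: hi hj; rewrite !mem_iota !size_partition_of_hooks !fc // => /(_ lj) hi /(_ li) hj.
by move: hi hj; rewrite E eqxx /= => -> ->.
Qed.

Lemma size_lambda : size (lambda a b w) = a.
Proof.
rewrite size_cat size_nseq subnKC //.
have [a0|a_gt0] := posnP a.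
  by rewrite size_sort size_map size_filter (leq_trans (count_size _ _)) // size_iota
     size_partition_of_hooks /positive_hooks a0.
rewrite lambda_unsorted size_sort size_map.
apply: (@size_T a b H) => //;
  first [exact: positive_hooks_gt0 | exact: a_notin | exact: b_notin | exact: hooks_subA
     | exact: hooks_subB | exact: tops_uniq | exact: tops_sub | exact: tops_mod].
Qed.

Lemma lambda_sorted : sorted geq (lambda a b w).
Proof.
have srt := sort_sorted geq_total [seq boundary_in_row b (core a b w) i | i <- rows_mod a (core a b w)].
rewrite /lambda; set s := sort _ _ in srt *.
elim: s srt (a - size s) => [|x s IH] /=.
  by move=> _ n; elim: n => //= n; case: n.
rewrite path_sortedE; last by move=> x1 y z /= h1 h2; apply: leq_trans h2 h1.
move=> /andP[h1 h2] n; rewrite path_sortedE; last by move=> x1 y z /= h3 h4; apply: leq_trans h4 h3.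
by rewrite IH // andbT all_cat h1 all_nseq /= leq0n orbT.
Qed.

Lemma lambda_bound i : i < a -> a * nth 0 (lambda a b w) i <= b * (a - i.+1).
Proof.
move=> ia; rewrite /lambda nth_cat lambda_unsorted; case: ifP => [|_]; last first.
  by rewrite nth_nseq if_same muln0.
rewrite size_sort size_map => hi.
apply: sorted_bound => //; first exact: leq_ltn_trans ia.
- exact: positive_hooks_gt0.
- exact: a_notin.
- exact: b_notin.
- exact: hooks_subA.
- exact: hooks_subB.
- exact: tops_uniq.
- exact: tops_sub.
exact: tops_mod.
Qed.

End DyckHooks.

Section BoundingPath.
Variable b : nat.

Fixpoint path_of (c : nat) (mu : seq nat) : seq bool :=
  if mu is m :: mu' then nseq (m - c) false ++ true :: path_of m mu'
  else nseq (b - c) false.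

Fixpoint north_steps (c : nat) (w : seq bool) : seq nat :=
  if w is s :: w' then if s then c :: north_steps c w' else north_steps c.+1 w'
  else [::].

Local Lemma count_path_of c mu : count id (path_of c mu) = size mu.
Proof.
elim: mu c => [|m mu IH] c /=; first by rewrite count_nseq.
by rewrite count_cat count_nseq /= IH mul0n.
Qed.

Local Lemma countN_path_of c mu : path leq c mu -> all (leq^~ b) (c :: mu) ->
  count negb (path_of c mu) = b - c.
Proof.
elim: mu c => [|m mu IH] c /=; first by rewrite count_nseq mul1n.
move=> /andP[cm pm] /and3P[cb mb hall].
by rewrite count_cat count_nseq /= mul1n add0n IH //=; [lia | rewrite mb].
Qed.

Local Lemma xpos_cons s w k : xpos (s :: w) k.+1 = ~~ s + xpos w k. Proof. by []. Qed.
Local Lemma ypos_cons s w k : ypos (s :: w) k.+1 = s + ypos w k. Proof. by []. Qed.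

Local Lemma aboveP w x y : reflect (exists k, x <= xpos w k /\ ypos w k <= y) (above w x y).
Proof.
apply: (iffP hasP) => [[k _ /andP[h1 h2]]|[k [h1 h2]]]; first by exists k.
have [le|lt] := leqP k (size w).
  by exists k; rewrite ?mem_iota ?h1 ?h2 //= add0n ltnS.
exists (size w); first by rewrite mem_iota /= add0n ltnS.
by move: h1 h2; rewrite /xpos /ypos take_size (take_oversize (ltnW lt)) => -> ->.
Qed.

Local Lemma above_east w x y : 0 < x -> above (false :: w) x y = above w x.-1 y.
Proof.
move=> x0; apply/aboveP/aboveP => [[[|k] [h1 h2]]|[k [h1 h2]]].
- by move: h1; rewrite leqNgt x0.
- by exists k; move: h1 h2; rewrite xpos_cons ypos_cons /=; lia.
by exists k.+1; rewrite xpos_cons ypos_cons /=; split; lia.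
Qed.

Local Lemma above_north w x y : 0 < x ->
  above (true :: w) x y = (0 < y) && above w x y.-1.
Proof.
move=> x0; apply/aboveP/andP => [[[|k] [h1 h2]]|[y0 /aboveP[k [h1 h2]]]].
- by move: h1; rewrite leqNgt x0.
- move: h1 h2; rewrite xpos_cons ypos_cons /= => h1 h2; split; first by lia.
  by apply/aboveP; exists k; split; lia.
by exists k.+1; rewrite xpos_cons ypos_cons /=; split; lia.
Qed.

Local Lemma above0 w y : above w 0 y.
Proof. by apply/aboveP; exists 0; rewrite /ypos take0. Qed.

Local Lemma above_easts n w x y : 0 < x ->
  above (nseq n false ++ w) x y = (x <= n) || above w (x - n) y.
Proof.
elim: n x => [|n IH] x x0 /=; first by rewrite subn0 leqNgt x0.
rewrite above_east //; case: x x0 => // -[|x] _ /=; first by rewrite above0.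
by rewrite IH.
Qed.

Local Lemma above_path_of c mu x y : path leq c mu -> 0 < x -> y < size mu ->
  above (path_of c mu) x y = (c + x <= nth 0 mu y).
Proof.
elim: mu c x y => [//|m mu IH] c x y /= /andP[cm pm] x0.
rewrite above_easts //; have [le|lt] := leqP x (m - c) => /=.
  have cxm : c + x <= m by lia.
  case: y => [|y]; rewrite ltnS /= ?cxm // => hy.
  rewrite (leq_trans cxm) //.
  move: pm; rewrite path_sortedE; last exact: leq_trans.
  by move=> /andP[/allP h _]; apply/h/mem_nth.
rewrite above_north ?subn_gt0 //; case: y => [|y] /=; first by lia.
by rewrite ltnS => hy; rewrite IH ?subn_gt0 //; congr (_ <= _); lia.
Qed.

Local Lemma bounded_path_of mu : path leq 0 mu -> all (leq^~ b) mu ->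
  bounded_partition (size mu) b (path_of 0 mu) = rev mu.
Proof.
move=> pmu mub; apply: (@eq_from_nth _ 0); rewrite size_map size_iota ?size_rev // => i hi.
rewrite (nth_map 0) ?size_iota // nth_iota // add0n nth_rev //.
have lt : size mu - i.+1 < size mu by lia.
set m := nth 0 mu _.
have mb : m <= b by apply: (allP mub); apply: mem_nth.
rewrite (eq_in_count (a2 := fun x => x <= m)); last first.
  by move=> x; rewrite mem_iota => /andP[x0 _]; rewrite above_path_of.
rewrite -(subnKC mb) iotaD count_cat.
have -> : count (fun x => x <= m) (iota 1 m) = m.
  rewrite -[RHS](size_iota 1); apply/eqP; rewrite -all_count.
  by apply/allP => x; rewrite mem_iota; lia.
suff -> : count (fun x => x <= m) (iota (1 + m) (b - m)) = 0 by rewrite addn0.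
apply/eqP; rewrite -leqn0 leqNgt -has_count; apply/negP => /hasP[x].
by rewrite mem_iota; lia.
Qed.

Local Lemma path_north_steps c w : path leq c (north_steps c w).
Proof.
elim: w c => [//|[] w IH] c /=; first by rewrite leqnn IH.
have := IH c.+1; case: (north_steps _ _) => //= m mu /andP[h ->].
by rewrite ltnW.
Qed.

Local Lemma size_north_steps c w : size (north_steps c w) = count id w.
Proof. by elim: w c => [//|[] w IH] c /=; rewrite IH. Qed.

Local Lemma north_steps_le c w : all (leq^~ (c + count negb w)) (north_steps c w).
Proof.
elim: w c => [//|[] w IH] c /=; first by rewrite leq_addr IH.
by rewrite add1n addnS -addSn IH.
Qed.

Local Lemma north_stepsK c w : c + count negb w = b -> path_of c (north_steps c w) = w.
Proof.
elim: w c => [|[] w IH] c /=.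
- by rewrite addn0 => ->; rewrite subnn.
- by rewrite add0n => E; rewrite subnn /= IH.
rewrite add1n addnS -addSn => E; rewrite -{2}(IH _ E).
have := path_north_steps c.+1 w; case: (north_steps _ _) => [|m mu] /=.
  by move=> _; rewrite -E addSn subSn ?leq_addr //= subSS.
by move=> /andP[h _]; rewrite -[m - c]prednK ?subn_gt0 // -subnS.
Qed.

Local Lemma dyck_path_of a c d mu k : a * c <= b * d -> d + size mu = a ->
  path leq c mu -> c <= b ->
  (forall i, i < size mu -> a * nth 0 mu i <= b * (d + i)) ->
  a * (c + xpos (path_of c mu) k) <= b * (d + ypos (path_of c mu) k).
Proof.
have easts n c' d' w : a * (c' + n) <= b * d' ->
    (forall l, a * (c' + n + xpos w l) <= b * (d' + ypos w l)) ->
    forall l, a * (c' + xpos (nseq n false ++ w) l) <= b * (d' + ypos (nseq n false ++ w) l).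
  elim: n c' => [|n IH] c' h1 h2 [|l].
  - by rewrite /xpos /ypos !take0 !addn0 -[c']addn0.
  - by move: (h2 l.+1); rewrite addn0.
  - by rewrite /xpos /ypos !take0 !addn0; apply: leq_trans h1; rewrite leq_mul2l leq_addr orbT.
  rewrite /= xpos_cons ypos_cons /= add0n addnA addn1; apply: IH; rewrite addSnnS //.
elim: mu c d k => [|m mu IH] c d k h1 h2 /=.
  move=> _ cb _; rewrite -[nseq _ _]cats0; apply: easts.
    by rewrite subnKC //; move: h2; rewrite addn0 => ->; rewrite mulnC.
  move=> l; rewrite /xpos /ypos /= !addn0 subnKC //.
  by move: h2; rewrite addn0 => ->; rewrite mulnC.
move=> /andP[cm pm] cb hh; have h0 := hh 0 isT; rewrite addn0 /= in h0.
apply: easts; rewrite subnKC // => -[|l].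
  by rewrite /xpos /ypos !take0 !addn0.
rewrite xpos_cons ypos_cons /= add0n addnA addn1.
have [a0|a0] := posnP a; first by rewrite a0.
apply: IH => //.
- by apply: leq_trans h0 _; rewrite leq_mul2l leqnSn orbT.
- by rewrite addSnnS.
- have da : d <= a by rewrite -h2 leq_addr.
  rewrite -(leq_pmul2l a0); apply: leq_trans h0 _.
  by rewrite mulnC leq_mul2r da orbT.
by move=> i hi; rewrite addSnnS; apply: (hh i.+1).
Qed.

End BoundingPath.

Lemma bounded_partition_inj a b w w' : is_dyck a b w -> is_dyck a b w' ->
  bounded_partition a b w = bounded_partition a b w' -> w = w'.
Proof.
suff aux v : is_dyck a b v ->
    bounded_partition a b v = rev (north_steps 0 v) /\ path_of b 0 (north_steps 0 v) = v.
  move=> /aux[E1 E2] /aux[E3 E4]; rewrite E1 E3 => E.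
  by rewrite -E2 -E4 -[north_steps 0 w]revK E revK.
case/and3P => /eqP ha /eqP hb _.
have K : path_of b 0 (north_steps 0 v) = v by rewrite north_stepsK ?add0n.
split => //; rewrite -(@bounded_path_of b) ?path_north_steps //.
  by rewrite size_north_steps ha K.
by have := north_steps_le 0 v; rewrite add0n hb.
Qed.

Lemma is_dyck_size a b w : is_dyck a b w -> size w = a + b.
Proof.
by case/and3P => /eqP<- /eqP<- _; rewrite -(count_predC id w).
Qed.

Record dyck_path (a b : nat) : predArgType :=
  DyckPath { steps :> (a + b).-tuple bool; _ : is_dyck a b steps }.

HB.instance Definition _ a b := [isSub for @steps a b].
HB.instance Definition _ a b := [Finite of dyck_path a b by <:].

Lemma zeta_exists (a b : nat) (cab : coprime a b) (P : dyck_path a b) :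
  exists Q : dyck_path a b, bounded_partition a b Q == lambda a b P.
Proof.
set L := lambda a b P; have zL : size L = a by apply: size_lambda.
pose mu := rev L; have zmu : size mu = a by rewrite size_rev.
have bmu i : i < a -> a * nth 0 mu i <= b * i.
  move=> ia; rewrite nth_rev zL //.
  have lt : a - i.+1 < a by lia.
  apply: leq_trans (lambda_bound P cab lt) _; rewrite leq_mul2l; apply/orP; right; lia.
have pmu : path leq 0 mu.
  rewrite path_sortedE; last exact: leq_trans.
  by rewrite rev_sorted lambda_sorted andbT; apply/allP.
have lmu : all (leq^~ b) mu.
  apply/(all_nthP 0) => i; rewrite zmu => ia.
  have a0 : 0 < a := leq_ltn_trans (leq0n _) ia.
  rewrite -(leq_pmul2l a0); apply: leq_trans (bmu _ ia) _.
  by rewrite mulnC leq_mul2r ltnW ?orbT.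
have dw : is_dyck a b (path_of b 0 mu).
  apply/and3P; split; first by rewrite count_path_of zmu.
    by rewrite countN_path_of ?subn0.
  apply/allP => k _; have := @dyck_path_of b a 0 0 mu k.
  by rewrite !add0n muln0 zmu; apply => //.
have zw := is_dyck_size dw.
exists (@DyckPath a b (@Tuple _ _ _ (introT eqP zw)) dw); apply/eqP.
by rewrite /= -{1}zmu bounded_path_of // revK.
Qed.

(* [bounded_partition_inj] shows that the chosen path is the only one. *)
Definition zeta (a b : nat) (cab : coprime a b) (P : dyck_path a b) : dyck_path a b :=
  xchoose (zeta_exists cab P).

Lemma zetaP (a b : nat) (cab : coprime a b) (P : dyck_path a b) :
  bounded_partition a b (zeta cab P) = lambda a b P.
Proof. exact/eqP/(xchooseP (zeta_exists cab P)). Qed.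

Section Conjugate.
Variables (a b : nat) (w : seq bool).
Hypotheses (cab : coprime a b) (ca : count id w = a) (cb : count negb w = b).

Local Lemma sz_w : size w = a + b.
Proof. by rewrite -ca -cb -(count_predC id w). Qed.

Local Lemma xy_pos k : k <= size w -> xpos w k + ypos w k = k.
Proof.
by move=> h; rewrite /xpos /ypos addnC -[RHS](size_takel h) -(count_predC id (take k w)).
Qed.

Local Lemma xpos_le k : xpos w k <= b.
Proof. by rewrite -cb -[w in count _ w](cat_take_drop k) count_cat leq_addr. Qed.

Local Lemma ypos_le k : ypos w k <= a.
Proof. by rewrite -ca -[w in count _ w](cat_take_drop k) count_cat leq_addr. Qed.

Local Lemma xpos_mono k l : k <= l -> xpos w k <= xpos w l.
Proof. by move=> kl; rewrite /xpos -(subnKC kl) takeD count_cat leq_addr. Qed.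

Local Lemma ypos_mono k l : k <= l -> ypos w k <= ypos w l.
Proof. by move=> kl; rewrite /ypos -(subnKC kl) takeD count_cat leq_addr. Qed.

Local Lemma level_inj k l : k < l -> l < size w ->
  b * ypos w k + a * xpos w l != b * ypos w l + a * xpos w k.
Proof.
move=> kl ln; apply/eqP => E.
have hx := xpos_mono (ltnW kl); have hy := ypos_mono (ltnW kl).
have E' : b * (ypos w l - ypos w k) = a * (xpos w l - xpos w k).
  have h1 : b * ypos w k <= b * ypos w l by rewrite leq_mul2l hy orbT.
  have h2 : a * xpos w k <= a * xpos w l by rewrite leq_mul2l hx orbT.
  by rewrite !mulnBr; lia.
have sk := xy_pos (ltnW (ltn_trans kl ln)); have sl := xy_pos (ltnW ln).
have zw := sz_w; have yl := ypos_le l; have xl := xpos_le l.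
have [b0|b0] := posnP b.
  by move: cab zw; rewrite b0 /coprime gcdn0 => /eqP->; lia.
have : b %| xpos w l - xpos w k.
  by rewrite -(@Gauss_dvdr b a) 1?coprime_sym // -E' dvdn_mulr.
have [d0|d0] := posnP (xpos w l - xpos w k).
  move: E'; rewrite d0 muln0 => /eqP; rewrite muln_eq0 => /orP[/eqP|/eqP]; lia.
move/(dvdn_leq d0) => hb.
have Ex : xpos w l - xpos w k = b by lia.
by move: E'; rewrite Ex [RHS]mulnC => /eqP; rewrite eqn_pmul2l // => /eqP; lia.
Qed.

Local Lemma has_strictly_below :
  has (fun k => strictly_below a b (rot k w)) (iota 0 (size w)).
Proof.
have n0 : 0 < size w.
  by rewrite sz_w; case: a b cab => [|?] [].
pose g (i : 'I_(size w)) := b * ypos w i + (a * b - a * xpos w i).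
case: (@arg_maxnP _ (Ordinal n0) xpredT g isT) => k _ kmax.
apply/hasP; exists (nat_of_ord k); first by rewrite mem_iota /= add0n.
have lk : k < size w by [].
have str m : m < size w -> m != k :> nat ->
    b * ypos w m + a * xpos w k < b * ypos w k + a * xpos w m.
  move=> hm ne; rewrite ltn_neqAle; apply/andP; split.
    have [lt|gt|E] := ltngtP m k; last by rewrite E eqxx in ne.
      exact: level_inj.
    by rewrite eq_sym addnC [X in _ != X]addnC addnC [X in _ != X]addnC; exact: level_inj.
  have := kmax (Ordinal hm) isT; rewrite /g /=.
  have h1 : a * xpos w m <= a * b by rewrite leq_mul2l xpos_le orbT.
  have h2 : a * xpos w k <= a * b by rewrite leq_mul2l xpos_le orbT.
  lia.
move: (nat_of_ord k) str lk => {kmax g}k str lk.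
suff aux j : 0 < j -> j < size w -> b * ypos (rot k w) j < a * xpos (rot k w) j.
  apply/allP => j; rewrite size_rot mem_iota => /andP[j0 jn]; apply: aux => //.
  by move: jn; rewrite add1n prednK.
move=> j0 jn; rewrite /xpos /ypos /rot take_cat size_drop; case: (ltnP j (size w - k)) => hj.
  have := str (k + j); rewrite /xpos /ypos takeD !count_cat !mulnDr => h.
  have h1 : k + j < size w by lia.
  have h2 : k + j != k by lia.
  by have := h h1 h2; lia.
have hm : j - (size w - k) <= k by lia.
rewrite take_takel // !count_cat.
have h1 : j - (size w - k) < size w by lia.
have h2 : j - (size w - k) != k by lia.
have := str _ h1 h2.
have := count_cat id (take k w) (drop k w); rewrite cat_take_drop ca => Ea.
have := count_cat negb (take k w) (drop k w); rewrite cat_take_drop cb => Eb.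
rewrite /xpos /ypos !mulnDr.
have Ea' : b * a = b * count id (take k w) + b * count id (drop k w) by rewrite -mulnDr -Ea.
have Eb' : a * b = a * count negb (take k w) + a * count negb (drop k w) by rewrite -mulnDr -Eb.
by rewrite mulnC in Ea'; lia.
Qed.

Lemma conj_word_dyck : is_dyck a b (conj_word a b w).
Proof.
rewrite /conj_word; set k := find _ _; set v := rot k w.
have sb : strictly_below a b v.
  have hk : k < size w by rewrite -[X in _ < X](size_iota 0) -has_find has_strictly_below.
  by have := nth_find 0 has_strictly_below; rewrite -/k nth_iota.
have va : count id v = a by rewrite -ca; apply/permP; rewrite perm_rot.
have vb : count negb v = b by rewrite -cb; apply/permP; rewrite perm_rot.
have zv : size v = a + b by rewrite size_rot sz_w.
apply/and3P; split; rewrite ?count_rev ?va ?vb //.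
suff aux j : j <= size v -> a * xpos (rev v) j <= b * ypos (rev v) j.
  by apply/allP => j; rewrite mem_iota size_rev add0n ltnS => /aux.
move=> jn; rewrite /xpos /ypos take_rev !count_rev.
have Ea := count_cat id (take (size v - j) v) (drop (size v - j) v).
have Eb := count_cat negb (take (size v - j) v) (drop (size v - j) v).
rewrite !cat_take_drop va in Ea Eb; rewrite vb in Eb.
have [->|j0] := posnP j; first by rewrite subn0 drop_size /= !muln0.
have [->|jn'] := eqVneq j (size v); first by rewrite subnn drop0 va vb mulnC.
have := allP sb (size v - j); rewrite mem_iota.
have -> : 1 <= size v - j < 1 + (size v).-1 by lia.
move=> /(_ isT).
rewrite /xpos /ypos.
have Ea' : b * a = b * count id (take (size v - j) v) + b * count id (drop (size v - j) v)
  by rewrite -mulnDr -Ea.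
have Eb' : a * b = a * count negb (take (size v - j) v) + a * count negb (drop (size v - j) v)
  by rewrite -mulnDr -Eb.
by rewrite mulnC in Ea'; lia.
Qed.

End Conjugate.

Lemma conj_path_dyck (a b : nat) (cab : coprime a b) (P : dyck_path a b) :
  is_dyck a b (conj_word a b P).
Proof. by case: P => w dw /=; case/and3P: (dw) => /eqP ? /eqP ? _; apply: conj_word_dyck. Qed.

Lemma size_conj_word (a b : nat) (P : dyck_path a b) : size (conj_word a b P) == a + b.
Proof. by rewrite size_rev size_rot size_tuple. Qed.

Definition conj_path (a b : nat) (cab : coprime a b) (P : dyck_path a b) : dyck_path a b :=
  @DyckPath a b (Tuple (size_conj_word P)) (conj_path_dyck cab P).

(* [invF (bij_inj zeta_bij)] is the inverse function of zeta. *)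
Definition chi (a b : nat) (cab : coprime a b) (zeta_bij : bijective (zeta cab))
    (Q : dyck_path a b) : dyck_path a b :=
  zeta cab (conj_path cab (invF (bij_inj zeta_bij) Q)).

(* Main.v *)
Require Import Defs.
From mathcomp Require Import all_boot.
From mathcomp Require Import all_order all_algebra zify.

(** The level of a lattice point (x, y) is b y - a x.  Three facts carry the
    proof.

    A conjugated path is again a half-turned rotation of the original one, and
    a word has only one rotation lying strictly below the diagonal (a second
    one would start at a point whose level is both negative and positive).  A
    Dyck path turned by 180 degrees lies strictly below the diagonal by
    coprimality, so conjugating twice returns the path ([conj_wordK]).  Hence
    chi, which is conjugation transported along the bijection zeta, is an
    involution.

    The boxes of positive filling are split by a Dyck path into those below it,
    counted by the area, and all those above it ([area_bounded]).  So the area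
    of zeta(P) is a constant minus the size of lambda(P), and it remains to see
    that lambda(P) and lambda(P^c) have the same size.

    The size of lambda(P) is the number of pairs (north step, east step) of P
    with the east step starting at the lower level ([sumn_lambda]): the
    a-rows with positive hook t correspond to the north steps starting at level
    t + a, and the boundary boxes of that row to the non-hooks in a window of
    length b below t; such a window meets every residue class modulo b once, at
    a non-hook exactly when the east step ending in this class ends below t.

    This number of pairs only depends on the multiset of starting levels up to
    a common translation, so it does not change under rotation.  A half-turn
    reverses the order and exchanges starts and ends of steps, which turns it
    into the number of pairs (n, e) of north and east starting levels with
    n + a + b < e.  To compare both numbers, choose a function f with
    f(x + a) - f(x) = [0 < x].  In a closed walk, any potential F satisfies
    sum_n (F(n + b) - F(n)) = sum_e (F(e) - F(e - a)).  Applying this to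
    F(l) = - f(n - l) and to F(l) = f(l - n - b), and summing over n, expresses
    both numbers through sums over pairs of north steps, and the two sums are
    exchanged by swapping the members of the pair ([crossings_rev]). *)

Set Implicit Arguments.
Unset Strict Implicit.
Unset Printing Implicit Defensive.
Import Order.TTheory GRing.Theory Num.Theory.

(** * Starting levels of the steps of a lattice path *)

Section Levels.
Variables a b : nat.

Definition rise (s : bool) : int := if s then Posz b else (- Posz a)%R.

(** Levels at which the steps of kind [s] start, for a path starting at level
    [c].  They are integers because a rotated Dyck path leaves the half-plane
    of nonnegative levels. *)
Fixpoint starts (s : bool) (c : int) (w : seq bool) : seq int :=
  if w is t :: w' then
    let r := starts s (c + rise t)%R w' in if t == s then c :: r else r
  else [::].

Definition total_rise (w : seq bool) : int :=
  (Posz b * Posz (count id w) - Posz a * Posz (count negb w))%R.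

(** For a Dyck path this is the skew length of its core. *)
Definition crossings (w : seq bool) : int :=
  (\sum_(n <- starts true 0 w) \sum_(e <- starts false 0 w) (e < n)%R%:R)%R.

Lemma total_rise_cons t w : total_rise (t :: w) = (rise t + total_rise w)%R.
Proof. by rewrite /total_rise /rise /=; case: t => /=; lia. Qed.

Lemma starts_shift s c d w : starts s (c + d)%R w = [seq (x + d)%R | x <- starts s c w].
Proof.
elim: w c => [//|t w IH] c /=; rewrite addrAC IH.
by case: ifP.
Qed.

Lemma starts_cat s c u v :
  starts s c (u ++ v) = starts s c u ++ starts s (c + total_rise u)%R v.
Proof.
elim: u c => [|t u IH] c /=; first by rewrite /total_rise /= !mulr0 subrr addr0.
by rewrite IH total_rise_cons (addrA c); case: ifP.
Qed.

(** Read backwards, a step of [w] starts where it used to end, and levels are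
    measured down from the end of the path. *)
Lemma starts_rev s c w :
  perm_eq (starts s c (rev w))
          [seq (c + total_rise w - (x + rise s))%R | x <- starts s 0 w].
Proof.
elim: w => [//|t w IH].
rewrite rev_cons -cats1 starts_cat /=.
have -> : total_rise (rev w) = total_rise w by rewrite /total_rise !count_rev.
rewrite starts_shift total_rise_cons.
have -> : (if t == s then [:: (c + total_rise w)%R] else [::]) =
   [seq (c + total_rise w - (x - rise t + rise s))%R | x <- if t == s then [:: 0%R] else [::]].
  by case: eqP => [->|] //=; rewrite sub0r addNr subr0.
have E : [seq (c + (rise t + total_rise w) - (x + rise s))%R | x <- [seq (x + rise t)%R | x <- starts s 0 w]]
   = [seq (c + total_rise w - (x + rise s))%R | x <- starts s 0 w].
  by rewrite -map_comp; apply: eq_map => x /=; lia.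
case: eqP => [ts|_] /=.
  rewrite E perm_catC /= ts; have -> : (c + total_rise w - (0 - rise s + rise s) = c + (rise s + total_rise w) - (0 + rise s))%R by lia.
  by rewrite perm_cons.
by rewrite E cats0.
Qed.

(** The increments of a potential along the path add up to its total increment;
    those of the east steps are moved to the other side with their sign. *)
Lemma telescope (F : int -> int) c w :
  (\sum_(n <- starts true c w) (F (n + Posz b) - F n) - \sum_(e <- starts false c w) (F e - F (e - Posz a))
   = F (c + total_rise w) - F c)%R.
Proof.
elim: w c => [|t w IH] c /=; first by rewrite !big_nil /total_rise /= !mulr0 subrr addr0 !subrr.
rewrite total_rise_cons (addrA c); have := IH (c + rise t)%R.
by case: t => /=; rewrite big_cons; set A := bigop.body _ _ _; set B := bigop.body _ _ _; move: A B (F (c + _ + _)%R) (F (c + _)%R) (F c) => /= *; lia.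
Qed.

Lemma total_rise_cat u v : total_rise (u ++ v) = (total_rise u + total_rise v)%R.
Proof. by rewrite /total_rise !count_cat; lia. Qed.

(** Rotating a closed walk translates all of its levels by the same amount. *)
Lemma crossings_rot k w : total_rise w = 0%R -> crossings (rot k w) = crossings w.
Proof.
rewrite -{1 3}(cat_take_drop k w) /rot; move: (take k w) (drop k w) => u v.
rewrite total_rise_cat => t0.
have E s : perm_eq (starts s 0 (v ++ u)) [seq (x - total_rise u)%R | x <- starts s 0 (u ++ v)].
  rewrite !starts_cat map_cat perm_catC !add0r -!starts_shift subrr sub0r.
  by rewrite (_ : total_rise v = - total_rise u)%R //; lia.
rewrite /crossings (perm_big _ (E true)) big_map; apply: eq_bigr => n _.
rewrite (perm_big _ (E false)) big_map; apply: eq_bigr => e _.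
by rewrite ltrD2r.
Qed.

(** An integer solution of the difference equation of [ramp_step]. *)
Definition ramp (x : int) : int := if x is Posz x'.+1 then Posz (x' %/ a) else 0%R.

Lemma ramp_step : 0 < a -> forall x, (ramp (x + Posz a) - ramp x = (0 < x)%R%:R)%R.
Proof.
move=> a0 [[|x]|x].
- rewrite add0r ltxx subr0 /ramp; case: a a0 => // n _; by rewrite divn_small.
- have -> : (Posz x.+1 + Posz a = (x + a).+1)%R by lia.
  by rewrite /ramp divnDr ?dvdnn // divnn a0; lia.
rewrite /= subr0; case E : (_ + _)%R => [[|z]|z] //=.
by rewrite divn_small //; lia.
Qed.

(** Both sides are rewritten, by two potentials built from [ramp], as sums over
    pairs of north steps that differ by a swap of the two north steps. *)
Lemma crossings_rev w : 0 < a -> total_rise w = 0%R -> crossings (rev w) = crossings w.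
Proof.
move=> a0 t0; rewrite /crossings.
have tel (F : int -> int) : (\sum_(e <- starts false 0 w) (F e - F (e - Posz a)) = \sum_(n <- starts true 0 w) (F (n + Posz b) - F n) )%R.
  by have := telescope F 0 w; rewrite t0 addr0 subrr => /subr0_eq.
pose N := starts true 0 w.
rewrite (perm_big _ (starts_rev true 0 w)) big_map.
transitivity (\sum_(n <- N) \sum_(m <- N) (ramp (m - n) - ramp (m - n - Posz b)))%R.
  apply: eq_bigr => n _; rewrite (perm_big _ (starts_rev false 0 w)) big_map.
  transitivity (\sum_(e <- starts false 0 w) (ramp (e - n - Posz b) - ramp (e - Posz a - n - Posz b)))%R.
    apply: eq_bigr => e _.
    have := ramp_step a0 (e - Posz a - n - Posz b)%R.
    rewrite (_ : (e - Posz a - n - Posz b + Posz a = e - n - Posz b)%R); last by lia.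
    by move=> ->; rewrite /rise; congr (nat_of_bool _)%:R%R; lia.
  rewrite (tel (fun e => ramp (e - n - Posz b)))%R; apply: eq_bigr => m _.
  by congr (ramp _ - ramp _)%R; lia.
rewrite exchange_big /=; apply: eq_bigr => n _.
transitivity (\sum_(e <- starts false 0 w) (ramp (n - (e - Posz a)) - ramp (n - e)))%R.
  transitivity (\sum_(m <- N) (- ramp (n - (m + Posz b)) - - ramp (n - m)))%R.
    by apply: eq_bigr => m _; rewrite opprK [RHS]addrC; congr (_ - ramp _)%R; lia.
  by rewrite -(tel (fun e => - ramp (n - e)))%R; apply: eq_bigr => m _; rewrite opprK addrC.
apply: eq_bigr => e _; have := ramp_step a0 (n - e)%R.
rewrite (_ : (n - e + Posz a = n - (e - Posz a))%R); last by lia.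
by move=> ->; rewrite subr_gt0.
Qed.

End Levels.

(** * Conjugation of Dyck paths *)

Section Conjugation.
Variables a b : nat.

Lemma strictly_belowP u : strictly_below a b u ->
  forall k, 0 < k < size u -> b * count id (take k u) < a * count negb (take k u).
Proof.
move=> /allP h k /andP[k0 ku]; have := h k; rewrite mem_iota => ->//.
by rewrite k0 add1n prednK // (leq_ltn_trans _ ku).
Qed.

(** The point where the rotation cuts [u] has negative level, so the starting
    point of [u] has positive level when measured from there. *)
Lemma strictly_below_rot_eq u k : count id u = a -> count negb u = b ->
  strictly_below a b u -> strictly_below a b (rot k u) -> rot k u = u.
Proof.
move=> ua ub sb sbr.
have [|ku] := leqP (size u) k; first exact: rot_oversize.
have [->|k0] := posnP k; first exact: rot0.
have h1 := strictly_belowP sb (k := k); rewrite k0 ku in h1.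
have := strictly_belowP sbr (k := size u - k).
have -> : take (size u - k) (rot k u) = drop k u.
  by rewrite /rot take_cat size_drop ltnn subnn take0 cats0.
rewrite size_rot => h2; have {h1}h1 := h1 isT.
have {h2}h2 := h2 ltac:(lia).
have := count_cat id (take k u) (drop k u); rewrite cat_take_drop ua => Ea.
have := count_cat negb (take k u) (drop k u); rewrite cat_take_drop ub => Eb.
have : b * a < a * b by rewrite {1}Ea {2}Eb !mulnDr -addSn leq_add // ltnW.
by rewrite mulnC ltnn.
Qed.

Lemma strictly_below_rot_uniq w i j : count id w = a -> count negb w = b ->
  i <= size w -> j <= size w ->
  strictly_below a b (rot i w) -> strictly_below a b (rot j w) -> rot i w = rot j w.
Proof.
move=> wa wb iw jw si.
have -> : rot j w = rot j (rotr i (rot i w)) by rewrite rotK.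
have [ua ub] : count id (rot i w) = a /\ count negb (rot i w) = b.
  by split; [rewrite -wa | rewrite -wb]; apply/permP; rewrite perm_rot.
move: (rot i w) (size_rot i w) ua ub si => u zu ua ub si; rewrite /rotr.
rewrite rot_add_mod ?leq_subr ?zu // => sj.
by rewrite (strictly_below_rot_eq ua ub si sj).
Qed.

Hypothesis cab : coprime a b.

Lemma dyck_strict w k : is_dyck a b w -> 0 < k < size w ->
  a * count negb (take k w) < b * count id (take k w).
Proof.
move=> dw /andP[k0 kw]; case/and3P: dw => /eqP wa /eqP wb /allP/(_ k).
rewrite mem_iota add0n ltnS (ltnW kw) => /(_ isT) le.
have := Defs.level_inj cab wa wb k0 kw.
rewrite /xpos /ypos take0 !muln0 add0n addn0 => ne.
by rewrite ltn_neqAle ne.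
Qed.

Lemma rev_dyck_strictly_below w : is_dyck a b w -> strictly_below a b (rev w).
Proof.
move=> dw; apply/allP => k; rewrite mem_iota size_rev /ypos /xpos take_rev !count_rev => hk.
have lt : 0 < size w - k < size w by lia.
have := dyck_strict dw lt; case/and3P: dw => /eqP wa /eqP wb _.
move: (size w - k) => m h.
have := count_cat id (take m w) (drop m w); rewrite cat_take_drop wa => Ea.
have := count_cat negb (take m w) (drop m w); rewrite cat_take_drop wb => Eb.
have : a * b = b * a by rewrite mulnC.
by rewrite {2}Ea {1}Eb !mulnDr; lia.
Qed.

Lemma conj_wordE w : is_dyck a b w ->
  exists2 k, k < size w & conj_word a b w = rev (rot k w) /\ strictly_below a b (rot k w).
Proof.
case/and3P => /eqP wa /eqP wb _; have h := Defs.has_strictly_below cab wa wb.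
exists (find (fun k => strictly_below a b (rot k w)) (iota 0 (size w))).
  by rewrite -[X in _ < X](size_iota 0) -has_find.
split=> //; have := nth_find 0 h; rewrite nth_iota //.
by rewrite -[X in _ < X](size_iota 0) -has_find.
Qed.

(** Both [rev w] and the rotation chosen by the second conjugation are rotations
    of [conj_word a b w] lying strictly below the diagonal. *)
Lemma conj_wordK w : is_dyck a b w -> conj_word a b (conj_word a b w) = w.
Proof.
move=> dw; case/and3P: (dw) => /eqP wa /eqP wb _.
have dc := conj_word_dyck cab wa wb.
have [l lw [-> sl]] := conj_wordE dc; case/and3P: dc => /eqP ca /eqP cb _.
have [k kw [E sk]] := conj_wordE dw.
apply: (canLR revK).
have Ek : rot k (conj_word a b w) = rev w by rewrite E rev_rot rotrK.
rewrite -Ek; apply: strictly_below_rot_uniq => //; first exact: ltnW.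
  by rewrite E size_rev size_rot ltnW.
by rewrite Ek rev_dyck_strictly_below.
Qed.

Lemma crossings_conj w : 0 < a -> is_dyck a b w ->
  crossings a b (conj_word a b w) = crossings a b w.
Proof.
move=> a0 dw; have [k kw [-> _]] := conj_wordE dw.
case/and3P: dw => /eqP wa /eqP wb _.
have t0 : total_rise a b w = 0%R by rewrite /total_rise wa wb mulrC subrr.
rewrite crossings_rev ?crossings_rot //.
rewrite -t0 /total_rise; have /permP p := permEl (perm_rot k w).
by rewrite !p.
Qed.

End Conjugation.

(** * The area of a path and the partition it bounds *)

Section Area.

(** A step count grows by at most one at a time, so it reaches every smaller
    value [m] at a point from which a counted step leaves. *)
Lemma count_take_gt (p : pred bool) w k m : m < count p (take k w) ->
  exists j, [/\ j < k, j < size w, p (nth false w j) & count p (take j w) = m].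
Proof.
elim: k => [|k IH]; first by rewrite take0.
have [kw|kw] := ltnP k (size w); last first.
  have -> : take k.+1 w = take k w by rewrite !take_oversize // leqW.
  by case/IH=> j [h1 h2 h3 h4]; exists j; split => //; apply: leqW.
rewrite (take_nth false) // -cats1 count_cat /= addn0 => lt.
have [lt'|le] := ltnP m (count p (take k w)).
  by case: (IH lt') => j [h1 h2 h3 h4]; exists j; split => //; apply: leqW.
by exists k; move: lt; case: (p _) => //= lt; split => //; lia.
Qed.

Lemma count_takeS (p : pred bool) w k : k < size w ->
  count p (take k.+1 w) = count p (take k w) + p (nth false w k).
Proof. by move=> kw; rewrite (take_nth false) // -cats1 count_cat /= addn0. Qed.

Lemma count_take_le (p : pred bool) w k l : k <= l ->
  count p (take k w) <= count p (take l w).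
Proof. by move=> kl; rewrite -(subnKC kl) takeD count_cat leq_addr. Qed.

Lemma level_neq0 a b x y : coprime a b -> 0 < x <= b -> y < a -> b * y != a * x.
Proof.
move=> cab /andP[x0 xb] ya; apply/eqP => E.
have : b %| x by rewrite -(@Gauss_dvdr b a) -?E ?dvdn_mulr // coprime_sym.
move/(dvdn_leq x0) => bx; have Ex : x = b by lia.
by move: E; rewrite Ex mulnC => /eqP; rewrite eqn_pmul2r; [move/eqP | ]; lia.
Qed.

Variables (a b : nat) (w : seq bool).
Hypothesis (dw : is_dyck a b w).

Lemma count_norths : count id w = a. Proof. by case/and3P: dw => /eqP. Qed.
Lemma count_easts : count negb w = b. Proof. by case/and3P: dw => _ /eqP. Qed.

Lemma belowP x y : reflect (exists2 k, k <= size w & xpos w k < x /\ y < ypos w k) (below w x y).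
Proof.
apply: (iffP hasP) => [[k]|[k kw [h1 h2]]]; rewrite ?mem_iota.
  by rewrite add0n ltnS => kw /andP[]; exists k.
by exists k; rewrite ?mem_iota ?h1.
Qed.

Lemma aboveP x y : reflect (exists2 k, k <= size w & x <= xpos w k /\ ypos w k <= y) (above w x y).
Proof.
apply: (iffP hasP) => [[k]|[k kw [h1 h2]]]; rewrite ?mem_iota.
  by rewrite add0n ltnS => kw /andP[]; exists k.
by exists k; rewrite ?mem_iota ?h1.
Qed.

Lemma east_step x : 0 < x <= b ->
  exists j, [/\ j < size w, ~~ nth false w j & xpos w j = x.-1].
Proof.
move=> hx; have [|j [_ h1 h2 h3]] := @count_take_gt negb w (size w) x.-1.
  by rewrite take_size count_easts; lia.
by exists j.
Qed.

Lemma dyck_le k : k <= size w -> a * xpos w k <= b * ypos w k.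
Proof. by case/and3P: dw => _ _ /allP h kw; apply: h; rewrite mem_iota. Qed.

(** The east step of the column of the box passes either above or below it. *)
Lemma above_belowN x y : 0 < x <= b -> above w x y = ~~ below w x y.
Proof.
move=> hx; apply/aboveP/idP => [[k kw [h1 h2]]|/negP h].
  apply/belowP => -[l lw [h3 h4]].
  have [kl|lk] := leqP k l.
    by have := count_take_le negb w kl; rewrite -/(xpos w k) -/(xpos w l); lia.
  by have := count_take_le id w (ltnW lk); rewrite -/(ypos w k) -/(ypos w l); lia.
have [j [jw nj xj]] := east_step hx.
have xj1 := count_takeS negb jw; rewrite -/(xpos w j) -/(xpos w j.+1) nj xj in xj1.
have yj1 := count_takeS id jw; rewrite -/(ypos w j) -/(ypos w j.+1) (negbTE nj) addn0 in yj1.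
have [le|lt] := leqP (ypos w j) y.
  by exists j.+1 => //; rewrite yj1 xj1; split; lia.
by case: h; apply/belowP; exists j; [exact: ltnW | rewrite xj; split; lia].
Qed.

Hypothesis cab : coprime a b.

Lemma above_filling x y : 0 < x <= b -> y < a -> above w x y -> 0 < hook_filling a b (x, y).
Proof.
move=> hx ya /aboveP[k kw [h1 h2]]; rewrite /hook_filling subn_gt0 /= ltn_neqAle.
rewrite eq_sym level_neq0 //=; have := dyck_le kw.
have : a * x <= a * xpos w k by rewrite leq_mul2l h1 orbT.
have : b * ypos w k <= b * y by rewrite leq_mul2l h2 orbT.
lia.
Qed.

(** The right-hand side does not depend on the path: the boxes of positive
    filling below the path make up its area, and all boxes above it have
    positive filling. *)
Lemma area_bounded :
  area a b w + sumn (bounded_partition a b w) = count (fun p => 0 < hook_filling a b p) (grid a b).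
Proof.
have -> : sumn (bounded_partition a b w) = count (fun p => above w p.1 p.2) (grid a b).
  rewrite /grid /allpairs_dep count_flatten -map_comp.
  (* parts are listed from the top row down, the grid from the bottom row up *)
  rewrite /bounded_partition.
  have -> : [seq count (fun x => above w x (a - i.+1)) (iota 1 b) | i <- iota 0 a] =
     [seq count (fun x => above w x y) (iota 1 b) | y <- rev (iota 0 a)].
    apply: (@eq_from_nth _ 0); rewrite ?size_map ?size_rev // => i.
    rewrite size_iota => ia; rewrite !(nth_map 0) ?size_rev ?size_iota //.
    by rewrite nth_rev ?size_iota // !nth_iota //; lia.
  rewrite map_rev sumn_rev; congr sumn; apply: eq_map => y /=.
  by rewrite count_map.
rewrite /area /positive_hooks size_map size_filter addnC -count_predUI.
rewrite [X in _ + X](_ : _ = 0) ?addn0.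
  apply: eq_in_count => -[x y] /allpairsP[[y' x'] /= [hy hx [-> ->]]].
  rewrite !mem_iota add0n add1n ltnS /= in hx hy.
  have := above_filling hx hy; rewrite /= above_belowN //.
  by case: (below w x' y') => //= ->.
apply/eqP; rewrite -leqn0 leqNgt -has_count; apply/hasPn => -[x y].
case/allpairsP=> -[y' x'] /= [hy hx [-> ->]].
rewrite !mem_iota add0n add1n ltnS /= in hx hy.
by rewrite above_belowN //; case: (below _ _ _).
Qed.

End Area.

(** * Congruences with coprime coefficients *)

Lemma mul_mod_inj c d u v : coprime d c -> u < v + d -> v < u + d ->
  c * u = c * v %[mod d] -> u = v.
Proof.
move=> cdc; wlog uv : u v / u <= v => [W|_ lt].
  by have [/W//|/ltnW/W h] := leqP u v => ? ? E; apply/esym/h.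
have cuv : c * u <= c * v by rewrite leq_mul2l uv orbT.
move/esym/eqP; rewrite eqn_mod_dvd // -mulnBr Gauss_dvdr //.
by have [|p /(dvdn_leq p)] := posnP (v - u); lia.
Qed.

Lemma dvdn_add_mul c d g : coprime d c -> 0 < d -> 0 < c ->
  exists2 u, u < d & d %| g + c * u.+1.
Proof.
move=> cdc d0 c0; have [p q E _] := egcdnP d c0.
rewrite gcdnC (eqP cdc) in E.
(* [p] inverts [c] modulo [d] and [d.-1] stands for -1 *)
have hv : d %| g + c * (p * (g * d.-1)).
  rewrite mulnA (mulnC c) E mulnDl mul1n addnCA -mulnS prednK //.
  by rewrite -!mulnA (mulnCA q) dvdn_add ?(dvdn_mulr _ (dvdnn d)) ?(dvdn_mull _ (dvdnn d)).
move: (p * _) hv => v hv; exists ((v + d.-1) %% d); first by rewrite ltn_mod.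
rewrite /dvdn -modnDmr -modnMmr -addn1 modnDml addn1 -addnS prednK //.
by rewrite modnDr modnMmr modnDmr.
Qed.

(** * The size of the partition of a core as a number of pairs of steps *)

Section SkewLength.
Variables (a b : nat) (w : seq bool).
Hypothesis (a_gt0 : 0 < a) (b_gt0 : 0 < b) (cab : coprime a b) (dw : is_dyck a b w).

Local Notation H := (positive_hooks a b w).
Local Notation X k := (xpos w k).
Local Notation Y k := (ypos w k).
Definition level k := b * ypos w k - a * xpos w k.
Definition norths := [seq k <- iota 0 (size w) | nth false w k].
Definition easts := [seq k <- iota 0 (size w) | ~~ nth false w k].

Lemma mem_norths k : (k \in norths) = (k < size w) && nth false w k.
Proof. by rewrite mem_filter mem_iota add0n andbC. Qed.

Lemma mem_easts k : (k \in easts) = (k < size w) && ~~ nth false w k.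
Proof. by rewrite mem_filter mem_iota add0n andbC. Qed.

Lemma levelE k : k <= size w -> level k + a * X k = b * Y k.
Proof. by move=> kw; rewrite /level subnK // dyck_le. Qed.

Lemma north_step_pos k : k \in norths ->
  [/\ k < size w, X k.+1 = X k, Y k.+1 = (Y k).+1 & Y k < a].
Proof.
rewrite mem_norths => /andP[kw nk].
have := count_takeS negb kw; have := count_takeS id kw; rewrite nk /= addn0 addn1 => yE xE.
by split=> //; rewrite -yE -(count_norths dw) -[w in _ <= count id w]take_size count_take_le.
Qed.

Lemma east_step_pos k : k \in easts ->
  [/\ k < size w, X k.+1 = (X k).+1, Y k.+1 = Y k & X k < b].
Proof.
rewrite mem_easts => /andP[kw nk].
have := count_takeS negb kw; have := count_takeS id kw; rewrite nk (negbTE nk) addn0 addn1 => yE xE.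
by split=> //; rewrite -xE -(count_easts dw) -[w in _ <= count negb w]take_size count_take_le.
Qed.

Lemma east_level k : k \in easts -> level k = level k.+1 + a.
Proof.
case/east_step_pos => kw xk yk _.
by have := levelE kw; have := levelE (ltnW kw); rewrite xk yk mulnS; lia.
Qed.

(** In the row of a north step, the fillings of the boxes to its right are its
    starting level decreased by the positive multiples of [a]. *)
Lemma hooksP h : reflect
  (0 < h /\ exists2 k, k \in norths & exists m, h + a * m.+1 = level k) (h \in H).
Proof.
apply: (iffP (mem_positive_hooks _ _ _ _)) => [[x [y [hx ya /belowP[k kw [xk yk]] lt ->]]]|[h0 [k kN [m E]]]].
  split; first by lia.
  have [j [jk jw nj yj]] := count_take_gt yk.
  exists j; first by rewrite mem_norths jw.
  have xj := count_take_le negb w (ltnW jk); rewrite -/(X j) -/(X k) in xj.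
  exists (x - X j).-1; rewrite prednK; last by lia.
  have := levelE (ltnW jw); rewrite mulnBr /ypos yj.
  have : a * X j <= a * x by rewrite leq_mul2l; apply/orP; right; lia.
  by lia.
have [kw xk yk ya] := north_step_pos kN.
have Ek := levelE (ltnW kw).
have lt : a * (X k + m.+1) < b * Y k by rewrite mulnDr; lia.
exists (X k + m.+1), (Y k); split => //; last by rewrite mulnDr; lia.
  rewrite addnS /= -(leq_pmul2l a_gt0) -addnS (leq_trans (ltnW lt)) //.
  by rewrite mulnC leq_mul2r (ltnW ya) orbT.
by apply/belowP; exists k.+1 => //; rewrite xk yk; split; lia.
Qed.

(** The path separates the two sides of a column at its east step, so the
    non-hooks are obtained from the level at which this step ends by going up
    in steps of [b].  Every nonnegative integer is the filling of a box in one
    of the [b] columns once the grid is extended upwards. *)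
Lemma nonhooksP g : reflect (exists2 j, j \in easts & exists m, g = level j.+1 + b * m) (g \notin H).
Proof.
apply: (iffP negP) => [gH|[j jE [m ->]] /mem_positive_hooks].
  (* the column [u.+1] of the grid in which [g] is a filling *)
  have [u ub] : exists2 u, u < b & b %| g + a * u.+1.
    by apply: dvdn_add_mul; rewrite 1?coprime_sym //.
  case/dvdnP => y Ey.
  have [j [jw nj xj]] := east_step dw (x := u.+1) ub.
  have jE : j \in easts by rewrite mem_easts jw.
  have [_ xk yk _] := east_step_pos jE; have lE := levelE jw.
  rewrite /= in xj; rewrite xk yk xj in lE.
  exists j => //; have [le|lt] := leqP (Y j) y.
    by exists (y - Y j); rewrite mulnBr; have : b * Y j <= b * y; [rewrite leq_mul2l le orbT | lia].
  case: gH; apply/mem_positive_hooks; exists u.+1, y.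
  have ya : y < a by rewrite (leq_trans lt) // -(count_norths dw) -[w in _ <= count id w]take_size count_take_le // ltnW.
  have ne := level_neq0 cab (x := u.+1) (y := y) ub ya.
  split => //; last 2 first.
  - by lia.
  - by lia.
  by apply/belowP; exists j; [exact: ltnW | rewrite xj].
have [jw xj yj xb] := east_step_pos jE; have lE := levelE jw.
case=> x [y [hx ya /belowP[k kw [h1 h2]] lt E]].
have Ex : x = X j.+1.
  apply: (mul_mod_inj (c := a) (d := b)); rewrite 1?coprime_sym //; try lia.
  by rewrite -(modnMDl (Y j.+1 + m)) -[RHS](modnMDl y) [_ * b]mulnC [y * b]mulnC mulnDr; congr (_ %% _); lia.
have Ey : y = Y j.+1 + m.
  by apply/eqP; rewrite -(eqn_pmul2l (leq_ltn_trans (leq0n _) xb)) mulnDr; apply/eqP; rewrite Ex in E lt; lia.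
have [kj|jk] := leqP k j.
  by have := count_take_le id w kj; rewrite -/(Y j) -/(Y k); lia.
by have := count_take_le negb w jk; rewrite -/(X j.+1) -/(X k); lia.
Qed.

Lemma north_level_inj : {in norths &, forall k l, level k = level l %[mod a] -> k = l}.
Proof.
move=> k l kN lN E.
have [kw xk yk ya] := north_step_pos kN; have [lw xl yl ya'] := north_step_pos lN.
have Ey : Y k = Y l.
  apply: (mul_mod_inj (c := b) (d := a)) => //; try lia.
  rewrite -(levelE (ltnW kw)) -(levelE (ltnW lw)) !(mulnC a).
  by rewrite addnC modnMDl addnC modnMDl.
have [kl|lk|//] := ltngtP k l.
  by have := count_take_le id w kl; rewrite -/(Y k.+1) -/(Y l); lia.
by have := count_take_le id w lk; rewrite -/(Y l.+1) -/(Y k); lia.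
Qed.

Lemma east_level_inj : {in easts &, forall k l, level k.+1 = level l.+1 %[mod b] -> k = l}.
Proof.
move=> k l kE lE E.
have [kw xk yk xb] := east_step_pos kE; have [lw xl yl xb'] := east_step_pos lE.
have Ex : X k = X l.
  suff : X k.+1 = X l.+1 by lia.
  apply: (mul_mod_inj (c := a) (d := b)); rewrite 1?coprime_sym //; try lia.
  apply/eqP; rewrite -(eqn_modDl (level k.+1)) levelE // mulnC modnMl.
  by rewrite -modnDml E modnDml levelE // mulnC modnMl.
have [kl|lk|//] := ltngtP k l.
  by have := count_take_le negb w kl; rewrite -/(X k.+1) -/(X l); lia.
by have := count_take_le negb w lk; rewrite -/(X l.+1) -/(X k); lia.
Qed.

Local Notation tops := [seq nth 0 (sort geq H) i | i <- rows_mod a (core a b w)].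
Local Notation v h := (count (fun g => (g \notin H) && (h < g + b)) (iota 0 h)).

Lemma mem_tops t : t \in tops =
  (t \in H) && all (fun t' => (t' == t %[mod a]) ==> (t' <= t)) H.
Proof.
have fc i : i < size H -> hook_length (core a b w) i 0 = nth 0 (sort geq H) i.
  by move=> hi; rewrite first_column_hooks ?positive_hooks_uniq ?positive_hooks_gt0.
apply/mapP/andP => [[i]|[tH /allP tmax]].
  rewrite mem_filter mem_iota add0n size_partition_of_hooks => /andP[/allP imax iH] ->.
  split; first by rewrite -(mem_sort geq) mem_nth // size_sort.
  apply/allP => t'; rewrite -(mem_sort geq) => /(nthP 0)[j]; rewrite size_sort => jH <-.
  by have := imax j; rewrite mem_iota add0n !fc //; apply.
have := tH; rewrite -(mem_sort geq) => /(nthP 0)[i]; rewrite size_sort => iH Ei.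
exists i => //; rewrite mem_filter mem_iota add0n size_partition_of_hooks leq0n iH !andbT.
apply/allP => j; rewrite mem_iota add0n => jH.
by rewrite !fc // Ei; apply: tmax; rewrite -(mem_sort geq) mem_nth // size_sort.
Qed.

(** The largest hook of a residue class modulo [a] sits immediately to the right
    of the north step in its row; rows are determined by the residue. *)
Lemma tops_norths : perm_eq tops [seq level k - a | k <- norths & a < level k].
Proof.
apply: uniq_perm; first exact: Defs.tops_uniq.
  rewrite map_inj_in_uniq ?filter_uniq ?iota_uniq // => k l.
  rewrite mem_filter [in Z in _ -> Z -> _]mem_filter => /andP[ak kN] /andP[al lN] E.
  by apply: north_level_inj => //; rewrite (_ : level k = level l) //; lia.
move=> t; rewrite mem_tops; apply/andP/mapP => [[tH /allP tmax]|[k]].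
  have [t0 [k kN [m E]]] := hooksP _ tH; rewrite mulnS in E.
  exists k; first by rewrite mem_filter kN andbT; lia.
  have h : level k - a \in H by apply/hooksP; split; [lia | exists k => //; exists 0; lia].
  have := tmax _ h; rewrite (_ : level k - a = m * a + t) ?modnMDl ?eqxx /=; last by lia.
  by lia.
rewrite mem_filter => /andP[ak kN] ->; split.
  by apply/hooksP; split; [lia | exists k => //; exists 0; lia].
apply/allP => t' /hooksP[_ [l lN [m E]]]; apply/implyP => /eqP mE.
have -> : k = l; last by rewrite mulnS in E; lia.
apply: north_level_inj => //; rewrite -E -modnDmr modnMr addn0 mE.
by rewrite -{1}(subnK (ltnW ak)) modnDr.
Qed.

(** The integers from [t - b] to [t - 1] contain exactly one element of each
    residue class modulo [b]; since [t] is a hook, [t - b] is a hook or negative,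
    so leaving it out of the window loses nothing.  In the class of an east step
    ending at level [l], the non-hooks are [l], [l + b], ..., so the window
    contains one of them exactly when [l < t]: the largest one below [t]. *)
Lemma window_count t : t \in H -> v t = count (fun j => level j.+1 < t) easts.
Proof.
move=> tH; have [t0 _] := hooksP _ tH.
rewrite -!size_filter.
(* the element counted for an east step is the largest one of its class below [t] *)
rewrite -(size_map (fun j => level j.+1 + b * ((t - (level j.+1).+1) %/ b))).
apply: perm_size; apply: uniq_perm; first by rewrite filter_uniq ?iota_uniq.
  rewrite map_inj_in_uniq ?filter_uniq ?iota_uniq // => k l.
  rewrite mem_filter [in Z in _ -> Z -> _]mem_filter => /andP[_ kE] /andP[_ lE] E.
  apply: east_level_inj => //; move: E; set p := _ %/ b; set q := _ %/ b => E.
  by rewrite -(modnMDl p (level k.+1)) addnC mulnC E addnC mulnC modnMDl.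
move=> g; rewrite mem_filter mem_iota add0n; apply/idP/mapP => [|[j]].
  move=> /andP[/andP[/nonhooksP[j jE [m E]] tg] gt]; exists j.
    by rewrite mem_filter jE andbT; lia.
  rewrite E; congr (_ + b * _); rewrite E in tg gt.
  apply/esym/eqP; rewrite eqn_leq; apply/andP; split.
    by rewrite -ltnS ltn_divLR // mulSn mulnC; lia.
  by rewrite leq_divRL // mulnC; lia.
rewrite mem_filter => /andP[lt jE] ->; set q := _ %/ b.
have nH : level j.+1 + b * q \notin H by apply/nonhooksP; exists j => //; exists q.
have le : b * q <= t - (level j.+1).+1 by rewrite mulnC leq_divM.
have gt : t - (level j.+1).+1 < b * q.+1 by rewrite mulnC ltn_ceil.
have ne : t <> level j.+1 + b * q.+1.
  by move=> E; move: tH; apply/negP/nonhooksP; exists j => //; exists q.+1.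
rewrite nH /=; rewrite mulnS in gt ne; apply/andP; split; lia.
Qed.

Lemma starts_map s c (u : seq bool) : starts a b s c u =
  [seq (c + (Posz (b * ypos u k) - Posz (a * xpos u k)))%R
     | k <- iota 0 (size u) & nth false u k == s].
Proof.
elim: u c => [//|t u IH] c /=; rewrite IH.
have E : [seq (c + (Posz (b * ypos (t :: u) k) - Posz (a * xpos (t :: u) k)))%R
            | k <- iota 1 (size u) & nth false (t :: u) k == s] =
   [seq (c + rise a b t + (Posz (b * ypos u k) - Posz (a * xpos u k)))%R
            | k <- iota 0 (size u) & nth false u k == s].
  rewrite -[1]addn0 iotaDl filter_map -map_comp; apply: eq_map => k /=.
  by rewrite /xpos /ypos /= /rise !mulnDr add0n; case: t => /=; lia.
by case: eqP => _ //=; rewrite E // /xpos /ypos /= !muln0 subrr addr0.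
Qed.

Lemma starts_norths : starts a b true 0 w = [seq Posz (level k) | k <- norths].
Proof.
rewrite starts_map (eq_filter (a2 := nth false w)); last by move=> k; rewrite eqb_id.
apply/eq_in_map => k; rewrite -/norths mem_norths add0r => /andP[kw _].
by have := levelE (ltnW kw); lia.
Qed.

Lemma starts_easts : starts a b false 0 w = [seq Posz (level k) | k <- easts].
Proof.
rewrite starts_map (eq_filter (a2 := fun k => ~~ nth false w k)); last by move=> k; case: nth.
apply/eq_in_map => k; rewrite -/easts mem_easts add0r => /andP[kw _].
by have := levelE (ltnW kw); lia.
Qed.

(** The size of [lambda] is the skew length of the core.  A north step whose row
    has no positive hook starts at level at most [a], hence not above the
    start of any east step, so including it in the sum adds nothing. *)
Lemma sumn_lambda : Posz (sumn (lambda a b w)) = crossings a b w.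
Proof.
rewrite /lambda sumn_cat sumn_nseq mul0n addn0.
rewrite (perm_sumn (permEl (perm_sort _ _))) Defs.lambda_unsorted //.
rewrite (perm_sumn (perm_map _ tops_norths)) -map_comp.
transitivity (Posz (\sum_(k <- norths) count (fun j => level j < level k) easts)).
  congr Posz; rewrite sumnE big_map big_filter big_mkcond /=; apply: eq_big_seq => k kN.
  have ce : count (fun j => level j < level k) easts =
     count (fun j => level j.+1 + a < level k) easts.
    by apply: eq_in_count => j jE; rewrite east_level.
  rewrite ce; case: ltnP => ak.
    rewrite window_count; first by apply: eq_count => j; lia.
    by apply/hooksP; split; [lia | exists k => //; exists 0; lia].
  by apply/esym/eqP; rewrite -leqn0 leqNgt -has_count; apply/hasPn => j _; lia.
rewrite /crossings starts_norths starts_easts big_map.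
rewrite -natz natr_sum; apply: eq_bigr => k _.
rewrite big_map -sum1_count natr_sum big_mkcond; apply: eq_bigr => j _.
by rewrite ltz_nat; case: ltnP.
Qed.

End SkewLength.

Lemma conj_pathK (a b : nat) (cab : coprime a b) : involutive (@conj_path a b cab).
Proof. by case=> w dw; do 2! apply: val_inj; apply: conj_wordK. Qed.

Theorem proposition6p11 (a b : nat) (a_gt0 : 0 < a) (b_gt0 : 0 < b)
    (cab : coprime a b) (zeta_bij : bijective (@zeta a b cab)) :
  (forall Q : dyck_path a b, chi zeta_bij (chi zeta_bij Q) = Q) /\
  (forall Q : dyck_path a b, area a b (chi zeta_bij Q) = area a b Q).
Proof.
split=> Q; rewrite /chi.
  by rewrite invF_f conj_pathK f_invF.
rewrite -{2}[Q](f_invF (bij_inj zeta_bij)); move: (invF _ Q) => P.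
have dP : is_dyck a b P := valP P.
have dyck_zeta R : is_dyck a b (zeta cab R) := valP (zeta cab R).
have := area_bounded (dyck_zeta P) cab.
rewrite -(area_bounded (dyck_zeta (conj_path cab P)) cab) !zetaP.
suff -> : sumn (lambda a b (conj_path cab P)) = sumn (lambda a b P) by move/addIn.
apply/eqP; rewrite -eqz_nat !sumn_lambda ?crossings_conj //.
exact: valP (conj_path cab P).
Qed.
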